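(* Let $\mathcal{S}_1$ and $\mathcal{S}_2$ be two descriptional systems, with associated complexity measures $c_1$ and $c_2$. Then the trade-off between $\mathcal{S}_1$ and $\mathcal{S}_2$ is non-recursive, if one of the following two cases applies: (1) both descriptional systems are recursive and the $\mathcal{S}_2$-ness of $\mathcal{S}_1$ descriptors is at least $\Sigma_2$-hard, or (2) at least one descriptional system is not recursive (but recursively enumerable) and the $\mathcal{S}_2$-ness of $\mathcal{S}_1$ descriptors is at least $\Sigma_3$-hard. Here hardness is meant with respect to many-one reducibility.
   Context: A descriptional system $\mathcal{S}$ is a recursive set of non-empty finite descriptors, such that each descriptor $D\in\mathcal{S}$ describes a formal language $L(D)$, and if $L(D)$ is recursive (recursively enumerable), then there exists an effective procedure to convert $D$ into a Turing machine that decides (semi-decides) $L(D)$. The system is called recursive (recursively enumerable) if all the languages $L(D)$, $D\in\mathcal{S}$, are recursive (recursively enumerable); every descriptional system is taken to be at most recursively enumerable, i.e. all languages it describes are recursively enumerable. Put $\mathscr{L}(\mathcal{S})=\{L(D)\mid D\in\mathcal{S}\}$ and $\mathcal{S}(L)=\{D\in\mathcal{S}\mid L(D)=L\}$. A complexity measure for $\mathcal{S}$ is a total recursive function $c:\mathcal{S}\to\mathbb{N}$ such that for any alphabet $A$, the set of descriptors in $\mathcal{S}$ describing languages over $A$ is recursively enumerable in order of increasing size, and does not contain infinitely many descriptors of the same size. Whenever two systems are compared, $\mathscr{L}(\mathcal{S}_1)\cap\mathscr{L}(\mathcal{S}_2)$ is assumed to be non-empty. A total function $f:\mathbb{N}\to\mathbb{N}$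 with $f(n)\ge n$ is an upper bound for the increase in complexity when changing from a descriptor in $\mathcal{S}_1$ to an equivalent descriptor in $\mathcal{S}_2$ if for all $D_1\in\mathcal{S}_1$ with $L(D_1)\in\mathscr{L}(\mathcal{S}_2)$ there exists $D_2\in\mathcal{S}_2(L(D_1))$ such that $c_2(D_2)\le f(c_1(D_1))$. The trade-off between $\mathcal{S}_1$ and $\mathcal{S}_2$ is non-recursive if there is no recursive upper bound. The $\mathcal{S}_2$-ness of $\mathcal{S}_1$ descriptors is the problem: given a descriptor $D_1\in\mathcal{S}_1$, does the language $L(D_1)$ belong to $\mathscr{L}(\mathcal{S}_2)$? $\Sigma_1$ is the class of recursively enumerable sets, and $\Sigma_{n+1}$ is the class of sets recursively enumerable in some set in $\Sigma_n$ (arithmetic hierarchy).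
   Formalization: For a complexity measure, the enumeration of descriptors of languages over A in order of increasing size is required to be effective uniformly in the alphabet A (one procedure taking A as input); with a separate enumeration for each alphabet the claim fails. *)

(* Defs.v *)
From mathcomp Require Import all_boot.

Set Implicit Arguments.
Unset Strict Implicit.
Unset Printing Implicit Defensive.

(* Bijection nat * nat -> nat: (x, y) |-> 2^x (2y + 1) - 1, chosen so that
   CodeSeq.code (x :: s) = (npair x (CodeSeq.code s)).+1. *)
Definition npair (x y : nat) : nat := (2 ^ x * y.*2.+1).-1.
Definition nleft (z : nat) : nat := logn 2 z.+1.
Definition nright (z : nat) : nat := (z.+1 %/ 2 ^ nleft z)./2.

Lemma code_cons x s :
  CodeSeq.code (x :: s) = (npair x (CodeSeq.code s)).+1.
Proof. by rewrite /npair prednK // muln_gt0 expn_gt0. Qed.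

Lemma nleft_pair x y : nleft (npair x y) = x.
Proof.
rewrite /nleft /npair prednK ?muln_gt0 ?expn_gt0 //.
rewrite lognM ?expn_gt0 // pfactorK // logn_coprime ?addn0 //.
by rewrite prime_coprime // dvdn2 /= odd_double.
Qed.

Lemma nright_pair x y : nright (npair x y) = y.
Proof.
rewrite /nright nleft_pair /npair prednK ?muln_gt0 ?expn_gt0 //.
by rewrite mulKn ?expn_gt0 //= uphalf_double.
Qed.

(* Programs for the partial recursive functions (unary, with pairing), with an
   oracle instruction. *)
Inductive prog : Type :=
  | Zero
  | Succ
  | Left
  | Right
  | Oracle
  | Pair of prog & prog
  | Comp of prog & prog
  | Prec of prog & prog
  | Mu of prog.

(* [computes O p x y]: with oracle O, p halts on input x with output y.
   Prec p q computes h(npair a n), where h(a, 0) = p a and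
   h(a, n + 1) = q (npair a (npair n (h(a, n)))).
   Mu p returns the least y with p (npair x y) = 0, provided that p converges
   at all smaller arguments. *)
Fixpoint computes (O : nat -> Prop) (p : prog) (x y : nat) : Prop :=
  match p with
  | Zero => y = 0
  | Succ => y = x.+1
  | Left => y = nleft x
  | Right => y = nright x
  | Oracle => (O x /\ y = 1) \/ (~ O x /\ y = 0)
  | Pair p q => exists a b,
      [/\ computes O p x a, computes O q x b & y = npair a b]
  | Comp p q => exists2 z, computes O q x z & computes O p z y
  | Prec p q =>
      (fix rec (n r : nat) : Prop :=
         match n with
         | 0 => computes O p (nleft x) r
         | n'.+1 => exists2 r', rec n' r' &
                      computes O q (npair (nleft x) (npair n' r')) r
         end) (nright x) y
  | Mu p => computes O p (npair x y) 0 /\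
      (forall k, k < y -> exists v, computes O p (npair x k) v.+1)
  end.

(* Plain computability is computability with the empty oracle. *)
Definition no_oracle : nat -> Prop := fun _ => False.

Definition recursive_fun (f : nat -> nat) : Prop :=
  exists p, forall n, computes no_oracle p n (f n).

Definition recursive_set (P : nat -> Prop) : Prop :=
  exists p, forall n, (P n /\ computes no_oracle p n 1)
                   \/ (~ P n /\ computes no_oracle p n 0).

Definition re_in (O P : nat -> Prop) : Prop :=
  exists p, forall n, P n <-> exists m, computes O p n m.

Definition re_set (P : nat -> Prop) : Prop := re_in no_oracle P.

Inductive Sigma : nat -> (nat -> Prop) -> Prop :=
  | Sigma_one P : re_set P -> Sigma 1 P
  | Sigma_succ n O P : Sigma n O -> re_in O P -> Sigma n.+1 P.

Definition many_one (P Q : nat -> Prop) : Prop :=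
  exists2 f, recursive_fun f & forall n, P n <-> Q (f n).

Definition Sigma_hard (n : nat) (Q : nat -> Prop) : Prop :=
  forall P, Sigma n P -> many_one P Q.

(* Symbols are natural numbers; CodeSeq.code and CodeSeq.decode are inverse
   bijections between words and natural numbers. *)
Definition word := seq nat.

Definition word_set (W : word -> Prop) : nat -> Prop :=
  fun n => W (CodeSeq.decode n).

(* A formal language comes with the finite alphabet over which it is taken; a
   list stands for the finite set of its entries. *)
Record language := Language {
  alph : seq nat;
  in_lang :> word -> Prop;
  lang_alph : forall w, in_lang w -> {subset w <= alph}
}.

Definition lang_eq (L1 L2 : language) : Prop :=
  alph L1 =i alph L2 /\ forall w, L1 w <-> L2 w.

Definition over (A : seq nat) (L : language) : Prop := {subset alph L <= A}.

Definition recursive_lang (L : language) : Prop := recursive_set (word_set L).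
Definition re_lang (L : language) : Prop := re_set (word_set L).

(* Deterministic one-tape Turing machines, given by their transition table
   ((state, read), (new state, written, move right?)); the first applicable row
   is used.  Tape symbol 0 is the blank, and the input symbol a is written on
   the tape as a.+1.  The initial state is 0, and a machine accepts when it
   halts in state 1. *)
Definition tm := seq ((nat * nat) * (nat * nat * bool)).

Definition tm_code (M : tm) : nat :=
  CodeSeq.code [seq CodeSeq.code [:: r.1.1; r.1.2; r.2.1.1; r.2.1.2;
                                     nat_of_bool r.2.2] | r <- M].

(* The tape to the left of the head is listed from right to left. *)
Record config := Config {
  state : nat;
  tape_left : seq nat;
  tape_head : nat;
  tape_right : seq nat
}.

Definition tm_init (w : word) : config :=
  let t := map S w in Config 0 [::] (head 0 t) (behead t).

Definition tm_step (M : tm) (c : config) : option config :=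
  let: Config q l a r := c in
  match ohead [seq t.2 | t <- M & t.1 == (q, a)] with
  | None => None
  | Some (q', b, true) => Some (Config q' (b :: l) (head 0 r) (behead r))
  | Some (q', b, false) => Some (Config q' (behead l) (head 0 l) (b :: r))
  end.

Definition tm_run (M : tm) (w : word) (n : nat) : config :=
  iter n (fun c => odflt c (tm_step M c)) (tm_init w).

Definition tm_halts (M : tm) (w : word) : Prop :=
  exists n, tm_step M (tm_run M w n) = None.

Definition tm_accepts (M : tm) (w : word) : Prop :=
  exists n, tm_step M (tm_run M w n) = None /\ state (tm_run M w n) = 1.

Definition tm_semidecides (M : tm) (L : language) : Prop :=
  forall w, {subset w <= alph L} -> (tm_accepts M w <-> L w).

Definition tm_decides (M : tm) (L : language) : Prop :=
  tm_semidecides M L /\ forall w, {subset w <= alph L} -> tm_halts M w.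

(* Descriptors are non-empty words; [lang D] is irrelevant unless [desc D]. *)
Record descriptional_system := DescriptionalSystem {
  desc : word -> Prop;
  lang : word -> language;
  desc_recursive : recursive_set (word_set desc);
  desc_nonempty : forall D, desc D -> D <> [::];
  lang_re : forall D, desc D -> re_lang (lang D);
  lang_to_semidecider :
    exists p, forall D, desc D -> exists M,
      computes no_oracle p (CodeSeq.code D) (tm_code M) /\
      tm_semidecides M (lang D);
  lang_to_decider :
    (forall D, desc D -> recursive_lang (lang D)) ->
    exists p, forall D, desc D -> exists M,
      computes no_oracle p (CodeSeq.code D) (tm_code M) /\
      tm_decides M (lang D)
}.

Definition recursive_system (S : descriptional_system) : Prop :=
  forall D, desc S D -> recursive_lang (lang S D).

Definition describes (S : descriptional_system) (D : word) (L : language) :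
  Prop := desc S D /\ lang_eq (lang S D) L.

Definition described (S : descriptional_system) (L : language) : Prop :=
  exists D, describes S D L.

(* The program p, run on (A, 0), (A, 1), (A, 2), ..., lists exactly the
   descriptors of languages over A, by non-decreasing size.  The list may be
   finite: p then diverges from some index on. *)
Definition enumerates_by_size (S : descriptional_system) (c : word -> nat)
    (p : prog) (A : seq nat) : Prop :=
  let e i D :=
    computes no_oracle p (npair (CodeSeq.code A) i) (CodeSeq.code D) in
  (forall D, (desc S D /\ over A (lang S D)) <-> exists i, e i D) /\
  (forall i j Dj, i <= j -> e j Dj -> exists2 Di, e i Di & c Di <= c Dj).

Record complexity_measure (S : descriptional_system) (c : word -> nat) :
    Prop := ComplexityMeasure {
  measure_recursive :
    exists p, forall D, desc S D ->
      computes no_oracle p (CodeSeq.code D) (c D);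
  measure_enum : exists p, forall A, enumerates_by_size S c p A;
  measure_finite :
    forall A n, exists s : seq word, forall D,
      desc S D -> over A (lang S D) -> c D = n -> D \in s
}.

Definition upper_bound (S1 S2 : descriptional_system) (c1 c2 : word -> nat)
    (f : nat -> nat) : Prop :=
  (forall n, n <= f n) /\
  forall D1, desc S1 D1 -> described S2 (lang S1 D1) ->
    exists2 D2, describes S2 D2 (lang S1 D1) & c2 D2 <= f (c1 D1).

Definition nonrecursive_tradeoff (S1 S2 : descriptional_system)
    (c1 c2 : word -> nat) : Prop :=
  ~ exists2 f, recursive_fun f & upper_bound S1 S2 c1 c2 f.

(* The S2-ness of S1 descriptors, as a set of (codes of) descriptors. *)
Definition ness (S2 S1 : descriptional_system) : nat -> Prop :=
  word_set (fun D1 => desc S1 D1 /\ described S2 (lang S1 D1)).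

(* Main.v *)
(* Given a recursive bound f, S2-ness of S1 descriptors is a Pi_2 property: only
   the S2-descriptors of size at most f(c1(D1)) matter, these are finitely many
   over the alphabet of D1, and equality of the described languages is Pi_2.  A
   Pi_2 set is not Sigma_2-hard, by diagonalization.  This covers both cases, as
   Sigma_3-hard sets are Sigma_2-hard. *)

Require Import Defs.
From mathcomp Require Import all_boot.
From Stdlib Require Import Classical.

Set Implicit Arguments.
Unset Strict Implicit.
Unset Printing Implicit Defensive.

(** * Closure properties of recursive functions *)

(** The candidates in S2 are finite in number but cannot be listed effectively: an enumeration by
    size may stop, and then no stage reveals that every small descriptor has appeared. A bounded
    quantifier over them has no recursive bound, so the proof quantifies universally over all
    possible bounds, which a Pi_2 form tolerates. Equality of languages is Pi_2 because acceptance
    is Sigma_1 uniformly in the descriptor; this uniformity requires simulating, inside [prog], the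
    Turing machines that descriptors are converted to. A universal machine for [prog] itself
    provides both the normal form of computations and the index for the diagonal argument. *)

Lemma npairK z : npair (nleft z) (nright z) = z.
Proof.
rewrite /npair /nright; set q := z.+1 %/ 2 ^ nleft z.
have zE : z.+1 = 2 ^ nleft z * q by rewrite mulnC divnK ?pfactor_dvdnn.
have q_odd : odd q.
  apply: contraT => q_even; have /dvdnP[r qE] : 2 %| q by rewrite dvdn2.
  have : 2 ^ (nleft z).+1 %| z.+1.
    by apply/dvdnP; exists r; rewrite zE qE mulnCA -expnSr.
  by rewrite pfactor_dvdn // ltnn.
(* The successor is read as [true + _], so that [odd q] can replace [true]. *)
by rewrite -[(_./2).*2.+1]/(true + _) -q_odd odd_double_half -zE.
Qed.

Lemma leq_npair x y : y <= npair x y.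
Proof.
rewrite /npair -ltnS prednK ?muln_gt0 ?expn_gt0 //.
by rewrite (leq_trans _ (leq_pmull _ _)) ?expn_gt0 // ltnS -addnn leq_addr.
Qed.

Definition identity_prog : prog := Pair Left Right.

Lemma computes_identity O x : computes O identity_prog x x.
Proof. by exists (nleft x), (nright x); rewrite npairK. Qed.

Lemma computes_prec O p q (h : nat -> nat) x :
    computes O p (nleft x) (h 0) ->
    (forall k, computes O q (npair (nleft x) (npair k (h k))) (h k.+1)) ->
  computes O (Prec p q) x (h (nright x)).
Proof. by move=> h0 hS /=; elim: (nright x) => //= n IHn; exists (h n). Qed.

(** Names the local fixpoint of the [Prec] case of [computes], so that inductions on the recursion
    counter can mention it. *)
Definition prec_graph (O : nat -> Prop) (p q : prog) (a : nat) :=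
  fix rec (n r : nat) : Prop :=
    match n with
    | 0 => computes O p a r
    | n'.+1 => exists2 r', rec n' r' & computes O q (npair a (npair n' r')) r
    end.

Lemma computes_precE O p q x y :
  computes O (Prec p q) x y = prec_graph O p q (nleft x) (nright x) y.
Proof. by []. Qed.

Lemma recursive_id : recursive_fun (fun z => z).
Proof. by exists identity_prog; exact: computes_identity. Qed.

Lemma recursive_ext f g : f =1 g -> recursive_fun f -> recursive_fun g.
Proof. by move=> fg [p Hp]; exists p => n; rewrite -fg. Qed.

Lemma recursive_comp f g :
  recursive_fun f -> recursive_fun g -> recursive_fun (fun z => f (g z)).
Proof. by move=> [p Hp] [q Hq]; exists (Comp p q) => n; exists (g n). Qed.

Lemma recursive_succ f : recursive_fun f -> recursive_fun (fun z => (f z).+1).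
Proof. by apply: (recursive_comp (f := succn)); exists Succ. Qed.

Lemma recursive_const c : recursive_fun (fun=> c).
Proof. by elim: c => [|c]; [exists Zero | exact: recursive_succ]. Qed.

Lemma recursive_left f : recursive_fun f -> recursive_fun (fun z => nleft (f z)).
Proof. by apply: recursive_comp; exists Left. Qed.

Lemma recursive_right f :
  recursive_fun f -> recursive_fun (fun z => nright (f z)).
Proof. by apply: recursive_comp; exists Right. Qed.

Lemma recursive_pair f g :
  recursive_fun f -> recursive_fun g -> recursive_fun (fun z => npair (f z) (g z)).
Proof. by move=> [p Hp] [q Hq]; exists (Pair p q) => n; exists (f n), (g n). Qed.

Lemma recursive_pred f : recursive_fun f -> recursive_fun (fun z => (f z).-1).
Proof.
apply: (recursive_comp (f := predn)).
(* The recursion step returns its own counter: h(0) = 0 and h(k + 1) = k. The parameter 0 is a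
   dummy. *)
exists (Comp (Prec Zero (Comp Left Right)) (Pair Zero identity_prog)) => n.
exists (npair 0 n).
  by exists 0, n; split=> //; exact: computes_identity.
rewrite -{2}[n](nright_pair 0); apply: computes_prec => // k.
by exists (npair k k.-1); rewrite /= ?nright_pair ?nleft_pair.
Qed.

(** Conditionals, subtraction, list traversals and machine simulations below all reduce to this form
    of iteration. *)
Lemma recursive_iter (h : nat -> nat -> nat) n i :
    recursive_fun (fun x => h (nleft x) (nright x)) ->
    recursive_fun n -> recursive_fun i ->
  recursive_fun (fun z => iter (n z) (h z) (i z)).
Proof.
move=> [ph Hh] [pn Hn] [pi Hi].
exists (Comp (Prec pi (Comp ph (Pair Left (Comp Right Right))))
             (Pair identity_prog pn)) => z.
exists (npair z (n z)); first by exists z, (n z); split=> //; exact: computes_identity.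
have := @computes_prec no_oracle pi (Comp ph (Pair Left (Comp Right Right)))
  (fun k => iter k (h z) (i z)) (npair z (n z)).
rewrite nright_pair nleft_pair; apply=> // k.
set r := iter k _ _; exists (npair z r).
  exists z, r; rewrite /= nleft_pair; split=> //.
  by exists (npair k r); rewrite /= nright_pair.
by have := Hh (npair z r); rewrite nleft_pair nright_pair.
Qed.

Definition recursive_test (b : nat -> bool) : Prop :=
  recursive_fun (fun z => nat_of_bool (b z)).

(** A conditional is an iteration performed [b z] times, that is at most once, starting from the
    value of the else branch. *)
Lemma recursive_if b f g :
    recursive_test b -> recursive_fun f -> recursive_fun g ->
  recursive_fun (fun z => if b z then f z else g z).
Proof.
move=> Hb Hf Hg.
have [|p Hp] := @recursive_iter (fun z _ => f z) _ _ _ Hb Hg.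
  exact/(recursive_comp Hf)/recursive_left/recursive_id.
by exists p => n; have := Hp n; case: (b n).
Qed.

Lemma recursive_eq0 f : recursive_fun f -> recursive_test (fun z => f z == 0).
Proof.
move=> Hf; have [|p Hp] := @recursive_iter (fun _ _ => 0) _ _ _ Hf (recursive_const 1).
  exact: recursive_const.
by exists p => n; have := Hp n; case: (f n).
Qed.

Lemma recursive_sub f g :
  recursive_fun f -> recursive_fun g -> recursive_fun (fun z => f z - g z).
Proof.
move=> Hf Hg; have [|p Hp] := @recursive_iter (fun _ => predn) _ _ _ Hg Hf.
  exact/recursive_pred/recursive_right/recursive_id.
exists p => n; have := Hp n; congr computes.
by elim: (g n) => [|k IHk]; rewrite ?subn0 //= IHk subnS.
Qed.

Lemma recursive_leq f g :
  recursive_fun f -> recursive_fun g -> recursive_test (fun z => f z <= g z).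
Proof. by move=> Hf Hg; exact/recursive_eq0/recursive_sub. Qed.

Lemma recursive_neg b : recursive_test b -> recursive_test (fun z => ~~ b z).
Proof.
by move=> /recursive_eq0[p Hp]; exists p => n; have := Hp n; case: (b n).
Qed.

Lemma recursive_and b c :
  recursive_test b -> recursive_test c -> recursive_test (fun z => b z && c z).
Proof.
move=> Hb Hc; have [p Hp] := recursive_if Hb Hc (recursive_const 0).
by exists p => n; have := Hp n; case: (b n).
Qed.

Lemma recursive_or b c :
  recursive_test b -> recursive_test c -> recursive_test (fun z => b z || c z).
Proof.
move=> Hb Hc; have [p Hp] := recursive_if Hb (recursive_const 1) Hc.
by exists p => n; have := Hp n; case: (b n).
Qed.

Lemma recursive_eq f g :
  recursive_fun f -> recursive_fun g -> recursive_test (fun z => f z == g z).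
Proof.
move=> Hf Hg; have [p Hp] := recursive_and (recursive_leq Hf Hg) (recursive_leq Hg Hf).
by exists p => n; rewrite eqn_leq.
Qed.

(** Lists are coded as by [CodeSeq.code], with 0 for the empty list. Head and tail of 0 are 0, in
    agreement with [head 0] and [behead], and hence with the blank beyond the ends of a tape. *)
Definition nhead (s : nat) : nat := nleft s.-1.
Definition ntail (s : nat) : nat := nright s.-1.
Definition npush (x s : nat) : nat := (npair x s).+1.

Lemma nhead_push x s : nhead (npush x s) = x.
Proof. exact: nleft_pair. Qed.

Lemma ntail_push x s : ntail (npush x s) = s.
Proof. exact: nright_pair. Qed.

Lemma nhead_code s : nhead (CodeSeq.code s) = head 0 s.
Proof. by case: s => // x s; rewrite code_cons nhead_push. Qed.

Lemma ntail_code s : ntail (CodeSeq.code s) = CodeSeq.code (behead s).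
Proof. by case: s => // x s; rewrite code_cons ntail_push. Qed.

Lemma recursive_nhead f : recursive_fun f -> recursive_fun (fun z => nhead (f z)).
Proof. by move=> Hf; exact/recursive_left/recursive_pred. Qed.

Lemma recursive_ntail f : recursive_fun f -> recursive_fun (fun z => ntail (f z)).
Proof. by move=> Hf; exact/recursive_right/recursive_pred. Qed.

Lemma recursive_npush f g :
  recursive_fun f -> recursive_fun g -> recursive_fun (fun z => npush (f z) (g z)).
Proof. by move=> Hf Hg; exact/recursive_succ/recursive_pair. Qed.

Ltac recursive_step :=
  lazymatch goal with
  | |- recursive_fun (fun x => x) => exact: recursive_id
  | |- recursive_fun nleft => exact: (recursive_left recursive_id)
  | |- recursive_fun nright => exact: (recursive_right recursive_id)
  | |- recursive_fun (fun _ => ?c) => exact: (recursive_const c)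
  | |- recursive_fun (fun x => S (@?f x)) => apply: (@recursive_succ f)
  | |- recursive_fun (fun x => predn (@?f x)) => apply: (@recursive_pred f)
  | |- recursive_fun (fun x => nleft (@?f x)) => apply: (@recursive_left f)
  | |- recursive_fun (fun x => nright (@?f x)) => apply: (@recursive_right f)
  | |- recursive_fun (fun x => nhead (@?f x)) => apply: (@recursive_nhead f)
  | |- recursive_fun (fun x => ntail (@?f x)) => apply: (@recursive_ntail f)
  | |- recursive_fun (fun x => npair (@?f x) (@?g x)) =>
      apply: (@recursive_pair f g)
  | |- recursive_fun (fun x => npush (@?f x) (@?g x)) =>
      apply: (@recursive_npush f g)
  | |- recursive_fun (fun x => iter (@?n x) (@?h x) (@?i x)) =>
      apply: (@recursive_iter h n i)
  | |- recursive_test (fun x => @?f x <= @?g x) => apply: (@recursive_leq f g)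
  | |- recursive_test (fun x => @?f x == @?g x) => apply: (@recursive_eq f g)
  | |- recursive_test (fun x => ~~ @?b x) => apply: (@recursive_neg b)
  | |- recursive_test (fun x => @?b x && @?c x) => apply: (@recursive_and b c)
  | |- recursive_test (fun x => @?b x || @?c x) => apply: (@recursive_or b c)
  | |- recursive_fun _ => simple apply recursive_if
  end.

Ltac recursive := cbv beta zeta; repeat (first [assumption | recursive_step]; cbv beta).

(** * A universal machine *)

(* Without an oracle, Oracle always answers 0, like Zero. *)
Fixpoint prog_code (p : prog) : nat :=
  match p with
  | Zero | Oracle => npair 0 0
  | Succ => npair 1 0
  | Left => npair 2 0
  | Right => npair 3 0
  | Pair p q => npair 4 (npair (prog_code p) (prog_code q))
  | Comp p q => npair 5 (npair (prog_code p) (prog_code q))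
  | Prec p q => npair 6 (npair (prog_code p) (prog_code q))
  | Mu p => npair 7 (prog_code p)
  end.

(* A machine state pairs the current value with a stack of frames: [fr_run]
   applies a program to the current value, the others are the continuations of
   Pair (first and second component), Prec and Mu. *)
Definition fr_run (c : nat) : nat := npair 0 c.
Definition fr_fst (c x : nat) : nat := npair 1 (npair c x).
Definition fr_snd (a : nat) : nat := npair 2 a.
Definition fr_prec (c a i n : nat) : nat :=
  npair 3 (npair c (npair a (npair i n))).
Definition fr_mu (c x k : nat) : nat := npair 4 (npair c (npair x k)).

Definition step_run (c x s : nat) : nat :=
  let t := nleft c in let d := nright c in
  if t == 0 then npair 0 s else
  if t == 1 then npair x.+1 s else
  if t == 2 then npair (nleft x) s else
  if t == 3 then npair (nright x) s else
  if t == 4 then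
    npair x (npush (fr_run (nleft d)) (npush (fr_fst (nright d) x) s)) else
  if t == 5 then
    npair x (npush (fr_run (nright d)) (npush (fr_run (nleft d)) s)) else
  if t == 6 then
    npair (nleft x) (npush (fr_run (nleft d))
      (npush (fr_prec (nright d) (nleft x) 0 (nright x)) s)) else
  npair (npair x 0) (npush (fr_run d) (npush (fr_mu d x 0) s)).

Definition step_prec (c a i n r s : nat) : nat :=
  if i == n then npair r s else
  npair (npair a (npair i r)) (npush (fr_run c) (npush (fr_prec c a i.+1 n) s)).

Definition step_mu (c x k r s : nat) : nat :=
  if r == 0 then npair k s else
  npair (npair x k.+1) (npush (fr_run c) (npush (fr_mu c x k.+1) s)).

Definition step_frame (f v s : nat) : nat :=
  let t := nleft f in let d := nright f in
  if t == 0 then step_run d v s else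
  if t == 1 then
    npair (nright d) (npush (fr_run (nleft d)) (npush (fr_snd v) s)) else
  if t == 2 then npair (npair d v) s else
  if t == 3 then
    step_prec (nleft d) (nleft (nright d)) (nleft (nright (nright d)))
              (nright (nright (nright d))) v s else
  step_mu (nleft d) (nleft (nright d)) (nright (nright d)) v s.

(** States with an empty stack are fixed points, so running longer than necessary does not change a
    final state. *)
Definition step (z : nat) : nat :=
  if nright z == 0 then z else
  step_frame (nhead (nright z)) (nleft z) (ntail (nright z)).

Lemma recursive_step_fun : recursive_fun step.
Proof.
rewrite /step /step_frame /step_run /step_prec /step_mu.
rewrite /fr_run /fr_fst /fr_snd /fr_prec /fr_mu.
recursive.
Qed.

Lemma step_cons v f s : step (npair v (npush f s)) = step_frame f v s.
Proof. by rewrite /step nleft_pair nright_pair nhead_push ntail_push. Qed.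

Lemma step_halt v : step (npair v 0) = npair v 0.
Proof. by rewrite /step nright_pair. Qed.

Lemma step_run_cons c v s : step (npair v (npush (fr_run c) s)) = step_run c v s.
Proof. by rewrite step_cons /step_frame /fr_run nleft_pair nright_pair. Qed.

Lemma step_fst c x v s : step (npair v (npush (fr_fst c x) s)) =
  npair x (npush (fr_run c) (npush (fr_snd v) s)).
Proof. by rewrite step_cons /step_frame /fr_fst !(nleft_pair, nright_pair). Qed.

Lemma step_snd a v s : step (npair v (npush (fr_snd a) s)) = npair (npair a v) s.
Proof. by rewrite step_cons /step_frame /fr_snd !(nleft_pair, nright_pair). Qed.

Lemma step_precE c a i n v s :
  step (npair v (npush (fr_prec c a i n) s)) = step_prec c a i n v s.
Proof. by rewrite step_cons /step_frame /fr_prec !(nleft_pair, nright_pair). Qed.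

Lemma step_muE c x k v s :
  step (npair v (npush (fr_mu c x k) s)) = step_mu c x k v s.
Proof. by rewrite step_cons /step_frame /fr_mu !(nleft_pair, nright_pair). Qed.

Definition stepE := (step_run_cons, step_fst, step_snd, step_precE, step_muE).

Definition reaches (z z' : nat) : Prop := exists t, iter t step z = z'.

Lemma reaches_trans z1 z2 z3 : reaches z1 z2 -> reaches z2 z3 -> reaches z1 z3.
Proof. by move=> [t <-] [u <-]; exists (u + t); rewrite iterD. Qed.

Lemma reaches_step z z' : reaches (step z) z' -> reaches z z'.
Proof. by move=> [t <-]; exists t.+1; rewrite iterSr. Qed.

Lemma reaches_refl z : reaches z z. Proof. by exists 0. Qed.

(** The arbitrary stack [s] carries the induction: the continuation frames of a program belong to
    the stack of its subprograms. *)
Lemma reaches_computes p x y s :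
    computes no_oracle p x y ->
  reaches (npair x (npush (fr_run (prog_code p)) s)) (npair y s).
Proof.
elim: p x y s => [||||| p IHp q IHq | p IHp q IHq | p IHp q IHq | p IHp] x y s;
  cbn [computes].
- by move=> ->; exists 1; rewrite /= step_run_cons /step_run nleft_pair.
- by move=> ->; exists 1; rewrite /= step_run_cons /step_run nleft_pair.
- by move=> ->; exists 1; rewrite /= step_run_cons /step_run nleft_pair.
- by move=> ->; exists 1; rewrite /= step_run_cons /step_run nleft_pair.
- move=> [[]//|[_ ->]].
  by exists 1; rewrite /= step_run_cons /step_run nleft_pair.
- move=> [a [b [Hp Hq ->]]]; apply: reaches_step.
  rewrite stepE /step_run !(nleft_pair, nright_pair).
  apply: reaches_trans (IHp _ _ _ Hp) _; apply: reaches_step.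
  rewrite stepE; apply: reaches_trans (IHq _ _ _ Hq) _; apply: reaches_step.
  by rewrite stepE; exact: reaches_refl.
- move=> [z Hq Hp]; apply: reaches_step.
  rewrite stepE /step_run !(nleft_pair, nright_pair).
  exact: reaches_trans (IHq _ _ _ Hq) (IHp _ _ _ Hp).
- rewrite -/(computes _ (Prec p q) x y) computes_precE.
  set rec := prec_graph _ _ _ _; set n := nright x.
  (* Loop invariant: the value [r] of round [i] lies on a [Prec] frame with counter [i]. *)
  have Hrec i r : i <= n -> rec i r -> reaches
      (npair x (npush (fr_run (prog_code (Prec p q))) s))
      (npair r (npush (fr_prec (prog_code q) (nleft x) i n) s)).
    elim: i r => [|i IHi] r.
      move=> _ Hr; apply: reaches_step.
      rewrite stepE /step_run !(nleft_pair, nright_pair); exact: IHp.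
    move=> lt_in /= [r' Hr' Hr]; apply: reaches_trans (IHi _ (ltnW lt_in) Hr') _.
    apply: reaches_step; rewrite stepE /step_prec (ltn_eqF lt_in); exact: IHq.
  move=> /(Hrec _ _ (leqnn n)) Hr; apply: reaches_trans Hr _.
  by apply: reaches_step; rewrite stepE /step_prec eqxx; exact: reaches_refl.
- move=> [Hy Hlt].
  have Hk k : k <= y -> reaches
      (npair x (npush (fr_run (prog_code (Mu p))) s))
      (npair (npair x k)
        (npush (fr_run (prog_code p)) (npush (fr_mu (prog_code p) x k) s))).
    elim: k => [_|k IHk lt_ky].
      apply: reaches_step; rewrite stepE /step_run !(nleft_pair, nright_pair).
      exact: reaches_refl.
    have [v Hv] := Hlt k lt_ky.
    apply: reaches_trans (IHk (ltnW lt_ky)) _.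
    apply: reaches_trans (IHp _ _ _ Hv) _.
    by apply: reaches_step; rewrite stepE; exact: reaches_refl.
  apply: reaches_trans (Hk y (leqnn y)) _; apply: reaches_trans (IHp _ _ _ Hy) _.
  by apply: reaches_step; rewrite stepE; exact: reaches_refl.
Qed.

(** A nonempty stack is not final, so a halting run from it makes at least one step. *)
Lemma iter_step_cons t v f s z :
    iter t step (npair v (npush f s)) = npair z 0 ->
  exists2 t', t = t'.+1 & iter t' step (step (npair v (npush f s))) = npair z 0.
Proof.
case: t => [/(congr1 nright)|t]; first by rewrite !nright_pair.
by rewrite iterSr; exists t.
Qed.

(** Converse of [reaches_computes]: a halting run of the whole stack passes through the moment when
    its top program has finished. The strict decrease [t' < t] is what makes the unbounded search of
    [Mu] well founded. *)
Lemma computes_iter_step p t x s z :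
    iter t step (npair x (npush (fr_run (prog_code p)) s)) = npair z 0 ->
  exists y t', [/\ computes no_oracle p x y, t' < t &
                   iter t' step (npair y s) = npair z 0].
Proof.
elim: p t x s => [||||| p IHp q IHq | p IHp q IHq | p IHp q IHq | p IHp] t x s
  /iter_step_cons[{}t ->]; rewrite stepE /step_run !(nleft_pair, nright_pair)
  => /= H.
- by exists 0, t.
- by exists x.+1, t.
- by exists (nleft x), t.
- by exists (nright x), t.
- by exists 0, t; split=> //; right; split=> // -[].
- have [a [t1 [Ha lt1 /iter_step_cons[t2 t1E]]]] := IHp _ _ _ H.
  rewrite stepE => /IHq[b [t3 [Hb lt3 /iter_step_cons[t4 t3E]]]].
  rewrite stepE => H4; exists (npair a b), t4; split=> //; first by exists a, b.
  by rewrite {}t1E {}t3E in lt1 lt3;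
     rewrite ltnS ltnW // (ltn_trans (ltnW lt3)) // ltnW.
- have [y [t1 [Hy lt1 /IHp[y' [t2 [Hy' lt2 H2]]]]]] := IHq _ _ _ H.
  by exists y', t2; split=> //; [exists y | rewrite ltnS ltnW // (ltn_trans lt2)].
- set rec := prec_graph no_oracle p q (nleft x); set n := nright x.
  (* Induction on the number [m] of rounds still to be done. *)
  have Hrec m : forall i r t', i + m = n -> rec i r ->
      iter t' step (npair r (npush (fr_prec (prog_code q) (nleft x) i n) s)) =
        npair z 0 ->
      exists y t'', [/\ rec n y, t'' < t' & iter t'' step (npair y s) = npair z 0].
    elim: m => [|m IHm] i r t' Ei Hr /iter_step_cons[u ->];
        rewrite stepE /step_prec.
      by move: Ei; rewrite addn0 => Ei; rewrite Ei eqxx in Hr * => Hu; exists r, u.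
    rewrite -{1}Ei -{1}[i]addn0 eqn_add2l /= => /IHq[r' [v [Hr' ltv]]].
    rewrite addnS -addSn in Ei.
    case/(IHm i.+1 _ _ Ei); first by exists r.
    move=> y [w [Hy ltw Hw]]; exists y, w; split=> //.
    by rewrite ltnS ltnW // (ltn_trans ltw).
  have [r [t1 [Hr lt1]]] := IHp _ _ _ H.
  case/(Hrec n 0 _ _ (add0n n) Hr) => y [t2 [Hy lt2 H2]]; exists y, t2; split=> //.
  by rewrite ltnS ltnW // (ltn_trans lt2).
(* The search has no bound known in advance, hence strong induction on the number [u] of remaining
   machine steps. *)
- suff Hk u : forall k, (forall j, j < k ->
        exists v, computes no_oracle p (npair x j) v.+1) ->
      iter u step (npair (npair x k)
        (npush (fr_run (prog_code p)) (npush (fr_mu (prog_code p) x k) s))) =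
        npair z 0 ->
      exists y t', [/\ computes no_oracle (Mu p) x y, t' < u &
                       iter t' step (npair y s) = npair z 0].
    have [//|y [t' [Hy ltt' Ht']]] := Hk t 0 _ H.
    by exists y, t'; split=> //; rewrite ltnS ltnW.
  elim/ltn_ind: u => u IHu k Hlt /IHp[v [t1 [Hv lt1 /iter_step_cons[t2 t1E]]]].
  rewrite stepE /step_mu; case: v Hv => [|v] Hv /= H2.
    by exists k, t2; split=> //; rewrite (ltn_trans _ lt1) ?t1E.
  have [||y [t' [Hy ltt' Ht']]] := IHu t2 _ k.+1 _ H2.
  + by rewrite (ltn_trans _ lt1) ?t1E.
  + by move=> j; rewrite ltnS leq_eqVlt => /predU1P[->|/Hlt//]; exists v.
  by exists y, t'; split=> //; rewrite (ltn_trans ltt') // (ltn_trans _ lt1) ?t1E.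
Qed.

Definition run (t c x : nat) : nat := iter t step (npair x (npush (fr_run c) 0)).

Lemma recursive_run f g h :
    recursive_fun f -> recursive_fun g -> recursive_fun h ->
  recursive_fun (fun z => run (f z) (g z) (h z)).
Proof.
move=> Hf Hg Hh; rewrite /run /fr_run; recursive.
exact: (recursive_comp recursive_step_fun (recursive_right recursive_id)).
Qed.

(** Kleene's normal form: the step count is the only unbounded quantifier, in front of a recursive
    equation. *)
Lemma computesP p x y :
  computes no_oracle p x y <-> exists t, run t (prog_code p) x = npair y 0.
Proof.
split=> [/reaches_computes|[t /computes_iter_step[y' [t' [Hy' _]]]]]; first exact.
rewrite iter_fix ?step_halt // => /(congr1 nleft).
by rewrite !nleft_pair => <-.
Qed.

(** Determinism is inherited from the universal machine: after [t + t'] steps both computations have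
    reached their final state. *)
Lemma computes_functional p x y y' :
  computes no_oracle p x y -> computes no_oracle p x y' -> y = y'.
Proof.
move=> /computesP[t Ht] /computesP[t' Ht'].
have: run (t + t') (prog_code p) x = run (t' + t) (prog_code p) x by rewrite addnC.
rewrite /run !iterD -!/(run _ _ _) Ht Ht' !iter_fix ?step_halt //.
by move/(congr1 nleft); rewrite !nleft_pair.
Qed.

(** * Coded lists and Turing machines *)

(** Lets the code of a list serve as the iteration count of a loop over it. *)
Lemma size_code_leq s : size s <= CodeSeq.code s.
Proof.
elim: s => // x s IHs; rewrite code_cons ltnS.
exact: leq_trans IHs (leq_npair x _).
Qed.

Lemma code_eq0 s : (CodeSeq.code s == 0) = nilp s.
Proof. by case: s => // x s; rewrite code_cons. Qed.

Definition search_step (test : nat -> bool) (s : nat) : nat :=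
  if (s == 0) || test (nhead s) then s else ntail s.

(** Returns the suffix starting at the first hit, not the hit itself: 0 then signals failure
    unambiguously, even when the hit is 0. *)
Definition search (test : nat -> bool) (s : nat) : nat :=
  iter s (search_step test) s.

Lemma search_code test s :
  search test (CodeSeq.code s) = CodeSeq.code (drop (find test s) s).
Proof.
suff iter_search n : size s <= n ->
    iter n (search_step test) (CodeSeq.code s) =
      CodeSeq.code (drop (find test s) s).
  exact/iter_search/size_code_leq.
elim: s n => [|x s IHs] n; first by move=> _; rewrite iter_fix.
have stepE : search_step test (CodeSeq.code (x :: s)) =
    if test x then CodeSeq.code (x :: s) else CodeSeq.code s.
  by rewrite /search_step nhead_code ntail_code code_eq0.
case: n => // n le_sn; rewrite [find _ _]/=; case: ifP stepE => _ stepE.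
  by rewrite iter_fix // drop0.
by rewrite iterSr stepE; exact: IHs.
Qed.

Lemma search_code_eq0 test s :
  (search test (CodeSeq.code s) == 0) = ~~ has test s.
Proof. by rewrite search_code code_eq0 /nilp size_drop subn_eq0 has_find -leqNgt. Qed.

Lemma recursive_search (test : nat -> nat -> bool) f :
    recursive_test (fun x => test (nleft x) (nright x)) -> recursive_fun f ->
  recursive_fun (fun z => search (test z) (f z)).
Proof.
move=> Htest Hf; apply: recursive_iter => //; rewrite /search_step.
apply: recursive_if; [apply: recursive_or | recursive | recursive].
  by recursive.
have Hg : recursive_fun (fun x => npair (nleft x) (nhead (nright x))) by recursive.
by apply: recursive_ext (recursive_comp Htest Hg) => x; rewrite nleft_pair nright_pair.
Qed.

Definition nsubset (w s : nat) : bool :=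
  search (fun a => search (fun b => b == a) s == 0) w == 0.

Lemma nsubsetP w s :
  reflect {subset CodeSeq.decode w <= CodeSeq.decode s} (nsubset w s).
Proof.
rewrite -{2}[w]CodeSeq.decodeK -{2}[s]CodeSeq.decodeK /nsubset search_code_eq0.
rewrite -all_predC; apply: (iffP allP) => sub a /sub; rewrite /= search_code_eq0.
  by rewrite negbK has_pred1.
by rewrite has_pred1 negbK.
Qed.

Lemma recursive_nsubset f g :
    recursive_fun f -> recursive_fun g ->
  recursive_test (fun z => nsubset (f z) (g z)).
Proof.
move=> Hf Hg; apply: recursive_eq0; apply: recursive_search => //.
apply: recursive_eq0; apply: recursive_search; first by recursive.
by apply: (recursive_comp Hg); recursive.
Qed.

Definition rev_map_step (h : nat -> nat) (z : nat) : nat :=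
  if nleft z == 0 then z else
  npair (ntail (nleft z)) (npush (h (nhead (nleft z))) (nright z)).

Definition rev_map (h : nat -> nat) (s : nat) : nat :=
  nright (iter s (rev_map_step h) (npair s 0)).

Lemma rev_map_code h s :
  rev_map h (CodeSeq.code s) = CodeSeq.code (rev (map h s)).
Proof.
suff iter_rev_map n acc : size s <= n ->
    iter n (rev_map_step h) (npair (CodeSeq.code s) (CodeSeq.code acc)) =
      npair 0 (CodeSeq.code (catrev (map h s) acc)).
  have := iter_rev_map _ [::] (size_code_leq s).
  by rewrite /rev_map => ->; rewrite nright_pair.
elim: s n acc => [|x s IHs] n acc.
  by move=> _; rewrite iter_fix // /rev_map_step nleft_pair.
case: n => // n le_sn; rewrite iterSr -[RHS](IHs n (h x :: acc)) //.
rewrite {2}/rev_map_step nleft_pair nright_pair nhead_code ntail_code code_eq0.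
by rewrite (code_cons (h x)).
Qed.

Lemma recursive_rev_map h f :
  recursive_fun h -> recursive_fun f -> recursive_fun (fun z => rev_map h (f z)).
Proof.
move=> Hh Hf; apply/recursive_right/recursive_iter => //; last by recursive.
rewrite /rev_map_step; apply: recursive_if; [by recursive | by recursive |].
apply: recursive_pair; first by recursive.
apply: recursive_npush; last by recursive.
by apply: (recursive_comp Hh); recursive.
Qed.

(** * Simulation of Turing machines on codes *)

Definition ncfg (q l a r : nat) : nat := npair q (npair l (npair a r)).

Definition cfg_code (c : config) : nat :=
  ncfg (state c) (CodeSeq.code (tape_left c)) (tape_head c)
       (CodeSeq.code (tape_right c)).

Definition tm_rows (m q a : nat) : nat :=
  search (fun row => (nhead row == q) && (nhead (ntail row) == a)) m.

Definition tm_move (act l r : nat) : nat :=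
  if nhead (ntail (ntail act)) == 0 then
    ncfg (nhead act) (ntail l) (nhead l) (npush (nhead (ntail act)) r)
  else ncfg (nhead act) (npush (nhead (ntail act)) l) (nhead r) (ntail r).

(* 0 stands for None, and [(cfg_code c).+1] for [Some c]. *)
Definition tm_next (m c : nat) : nat :=
  if tm_rows m (nleft c) (nleft (nright (nright c))) == 0 then 0 else
  (tm_move
     (ntail (ntail (nhead (tm_rows m (nleft c) (nleft (nright (nright c)))))))
     (nleft (nright c)) (nright (nright (nright c)))).+1.

Definition tm_iter (m t c : nat) : nat :=
  iter t (fun c => if tm_next m c == 0 then c else (tm_next m c).-1) c.

(** The accumulator loop [rev_map] reverses its list; the second pass restores the order. *)
Definition tm_start (w : nat) : nat :=
  ncfg 0 0 (nhead (rev_map id (rev_map succn w)))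
       (ntail (rev_map id (rev_map succn w))).

Definition tm_accept_at (m w t : nat) : bool :=
  (tm_next m (tm_iter m t (tm_start w)) == 0) &&
  (nleft (tm_iter m t (tm_start w)) == 1).

Lemma ohead_filter (T : Type) (P : pred T) s :
  ohead (filter P s) = ohead (drop (find P s) s).
Proof. by elim: s => //= x s; case: (P x). Qed.

Lemma tm_nextE M c :
  tm_next (tm_code M) (cfg_code c) =
  if tm_step M c is Some c' then (cfg_code c').+1 else 0.
Proof.
case: c => q l a r; rewrite /tm_next /cfg_code /ncfg /= !(nleft_pair, nright_pair).
pose rc (r : (nat * nat) * (nat * nat * bool)) := CodeSeq.code
  [:: r.1.1; r.1.2; r.2.1.1; r.2.1.2; nat_of_bool r.2.2].
have -> : tm_rows (tm_code M) q a =
    CodeSeq.code (map rc (drop (find (fun t => t.1 == (q, a)) M) M)).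
  rewrite /tm_rows search_code find_map map_drop.
  congr (CodeSeq.code (drop _ _)); apply: eq_find => -[[q1 a1] t].
  rewrite -[LHS]/((nhead (rc (q1, a1, t)) == q) &&
                  (nhead (ntail (rc (q1, a1, t))) == a)).
  by rewrite /rc ntail_code !nhead_code.
(* The filtered table is replaced by the suffix from the first applicable row, which is what the
   coded search yields. *)
have -> : ohead [seq t.2 | t <- M & t.1 == (q, a)] =
    omap snd (ohead (drop (find (fun t => t.1 == (q, a)) M) M)).
  by rewrite -ohead_filter; case: filter.
case: (drop _ M) => [|[[q1 a1] [[q2 b] d]] s] //.
rewrite code_eq0 nhead_code [head 0 _]/= /rc !ntail_code /tm_move.
by rewrite !(ntail_code, nhead_code) /ncfg /npush -!code_cons; case: d.
Qed.

Lemma tm_runE M w t :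
  tm_iter (tm_code M) t (tm_start (CodeSeq.code w)) = cfg_code (tm_run M w t).
Proof.
elim: t => [|t IHt]; last first.
  rewrite /tm_iter /tm_run !iterS -/(tm_iter _ _ _) -/(tm_run _ _ _) IHt tm_nextE.
  by case: (tm_step _ _).
rewrite /tm_iter /tm_start !rev_map_code map_id revK /=.
by rewrite nhead_code ntail_code.
Qed.

Lemma tm_acceptsP M w :
  tm_accepts M w <-> exists t, tm_accept_at (tm_code M) (CodeSeq.code w) t.
Proof.
split=> -[t Ht]; exists t; move: Ht; rewrite /tm_accept_at tm_runE tm_nextE.
  by move=> [-> /= st1]; rewrite /cfg_code /ncfg nleft_pair st1.
case: tm_step => //=; rewrite /cfg_code /ncfg nleft_pair => /eqP; by [].
Qed.

Lemma recursive_tm_next f g :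
    recursive_fun f -> recursive_fun g ->
  recursive_fun (fun z => tm_next (f z) (g z)).
Proof.
move=> Hf Hg; rewrite /tm_next /tm_move /ncfg.
have Hrows : recursive_fun
    (fun z => tm_rows (f z) (nleft (g z)) (nleft (nright (nright (g z))))).
  apply: recursive_search => //.
  have Hg' : recursive_fun (fun x => g (nleft x)).
    exact: (recursive_comp Hg (recursive_left recursive_id)).
  by recursive.
by recursive.
Qed.

Lemma recursive_tm_accept_at f g h :
    recursive_fun f -> recursive_fun g -> recursive_fun h ->
  recursive_test (fun z => tm_accept_at (f z) (g z) (h z)).
Proof.
move=> Hf Hg Hh; rewrite /tm_accept_at.
have Hrev : recursive_fun (fun z => rev_map id (rev_map succn (g z))).
  apply: recursive_rev_map; first exact: recursive_id.
  by apply: recursive_rev_map => //; exact/recursive_succ/recursive_id.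
have Hrun : recursive_fun (fun z => tm_iter (f z) (h z) (tm_start (g z))).
  rewrite /tm_iter /tm_start /ncfg; apply: recursive_iter => //.
    have Hnext : recursive_fun (fun x => tm_next (f (nleft x)) (nright x)).
      apply: recursive_tm_next; last by recursive.
      exact: (recursive_comp Hf (recursive_left recursive_id)).
    by recursive.
  by recursive.
have Hnext := recursive_tm_next Hf Hrun.
by recursive.
Qed.

(** * Semidecidable and Pi_2 predicates *)

(** Projection of a recursive relation rather than domain of a program: closure properties then only
    pair or share witnesses, without dovetailing. *)
Definition semidecidable (P : nat -> Prop) : Prop :=
  exists2 b, recursive_test b & forall n, P n <-> exists u, b (npair n u).

Lemma semidecidable_ext P Q :
  (forall n, P n <-> Q n) -> semidecidable P -> semidecidable Q.
Proof. by move=> PQ [b Hb HP]; exists b => // n; rewrite -PQ. Qed.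

Lemma semidecidable_test (b : nat -> bool) :
  recursive_test b -> semidecidable (fun n => b n).
Proof.
move=> Hb; exists (fun z => b (nleft z)).
  exact: (recursive_comp Hb (recursive_left recursive_id)).
move=> n; split=> [bn|[u]]; last by rewrite nleft_pair.
by exists 0; rewrite nleft_pair.
Qed.

Lemma semidecidable_comp P f :
  semidecidable P -> recursive_fun f -> semidecidable (fun z => P (f z)).
Proof.
move=> [b Hb HP] Hf; exists (fun z => b (npair (f (nleft z)) (nright z))).
  apply: (recursive_comp Hb); apply: recursive_pair; last by recursive.
  exact: (recursive_comp Hf (recursive_left recursive_id)).
by move=> n; rewrite HP; split=> -[u Hu]; exists u; move: Hu; rewrite nleft_pair nright_pair.
Qed.

Lemma semidecidable_comp2 (R : nat -> nat -> Prop) f g :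
    semidecidable (fun z => R (nleft z) (nright z)) ->
    recursive_fun f -> recursive_fun g ->
  semidecidable (fun z => R (f z) (g z)).
Proof.
move=> HR Hf Hg.
apply: semidecidable_ext (semidecidable_comp HR (recursive_pair Hf Hg)) => n.
by rewrite nleft_pair nright_pair.
Qed.

Ltac semidecidable_atom :=
  cbv beta;
  lazymatch goal with
  | |- semidecidable (fun x => ?R (@?f x) (@?g x)) =>
      apply: (@semidecidable_comp2 R f g); [assumption | recursive | recursive]
  end.

Lemma semidecidable_ex (P : nat -> nat -> Prop) :
    semidecidable (fun z => P (nleft z) (nright z)) ->
  semidecidable (fun n => exists m, P n m).
Proof.
move=> [b Hb HP].
exists (fun z => b (npair (npair (nleft z) (nleft (nright z))) (nright (nright z)))).
  by apply: (recursive_comp Hb); recursive.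
have HP' n m : P n m <-> exists u, b (npair (npair n m) u).
  by rewrite -HP nleft_pair nright_pair.
move=> n; split=> [[m /HP'[u Hu]]|[v]].
  by exists (npair m u); rewrite !(nleft_pair, nright_pair).
rewrite nleft_pair nright_pair => Hv; exists (nleft v).
by apply/HP'; exists (nright v).
Qed.

Lemma semidecidable_and P Q :
  semidecidable P -> semidecidable Q -> semidecidable (fun n => P n /\ Q n).
Proof.
move=> [b Hb HP] [c Hc HQ].
exists (fun z => b (npair (nleft z) (nleft (nright z))) &&
                 c (npair (nleft z) (nright (nright z)))).
  by apply: recursive_and; [apply: (recursive_comp Hb) | apply: (recursive_comp Hc)];
    recursive.
move=> n; rewrite HP HQ; split=> [[[u Hu] [v Hv]]|[u]].
  by exists (npair u v); rewrite !(nleft_pair, nright_pair) Hu.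
rewrite !(nleft_pair, nright_pair) => /andP[Hu Hv].
by split; [exists (nleft u) | exists (nright u)].
Qed.

Lemma semidecidable_or P Q :
  semidecidable P -> semidecidable Q -> semidecidable (fun n => P n \/ Q n).
Proof.
move=> [b Hb HP] [c Hc HQ]; exists (fun z => b z || c z); first exact: recursive_or.
move=> n; rewrite HP HQ; split=> [[[u Hu]|[u Hu]]|[u /orP[Hu|Hu]]].
- by exists u; rewrite Hu.
- by exists u; rewrite Hu orbT.
- by left; exists u.
- by right; exists u.
Qed.

Lemma semidecidable_computes p f g :
    recursive_fun f -> recursive_fun g ->
  semidecidable (fun z => computes no_oracle p (f z) (g z)).
Proof.
move=> Hf Hg.
apply: (semidecidable_ext (P := fun z =>
  exists t, run t (prog_code p) (f z) == npair (g z) 0)) => [n|].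
  by rewrite computesP; split=> -[t /eqP]; exists t => //; apply/eqP.
apply: semidecidable_ex; apply: semidecidable_test; apply: recursive_eq.
  apply: recursive_run; [by recursive | by recursive |].
  exact: (recursive_comp Hf (recursive_left recursive_id)).
apply: recursive_pair; last by recursive.
exact: (recursive_comp Hg (recursive_left recursive_id)).
Qed.

Lemma semidecidable_re P : semidecidable P -> re_set P.
Proof.
move=> [b /recursive_neg[p Hp] HP]; exists (Mu p) => n; rewrite HP.
split=> [exu | [m /= [Hm _]]].
  have [m Hm Hmin] := ex_minnP exu; exists m; split=> [|k lt_km].
    by have := Hp (npair n m); rewrite Hm.
  exists 0; have := Hp (npair n k); case Hk: (b _) => //.
  by have := Hmin k Hk; rewrite leqNgt lt_km.
exists m; have := computes_functional Hm (Hp (npair n m)); by case: (b _).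
Qed.

(** Defined for every number [e], code of a program or not, so that it is semidecidable uniformly in
    [e]. *)
Definition halts (e x : nat) : Prop := exists y t, run t e x == npair y 0.

Lemma halts_prog p x : halts (prog_code p) x <-> exists y, computes no_oracle p x y.
Proof.
split=> -[y]; first by case=> t /eqP Ht; exists y; apply/computesP; exists t.
by move=> /computesP[t Ht]; exists y, t; apply/eqP.
Qed.

Lemma semidecidable_halts : semidecidable (fun z => halts (nleft z) (nright z)).
Proof.
apply: semidecidable_ex; apply: semidecidable_ex; apply: semidecidable_test.
apply: recursive_eq; last by recursive.
by apply: recursive_run; recursive.
Qed.

Lemma semidecidable_prog P :
  semidecidable P -> exists e, forall n, P n <-> halts e n.
Proof.
by move=> /semidecidable_re[p Hp]; exists (prog_code p) => n; rewrite halts_prog.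
Qed.

(** * Closure properties of Pi_2 predicates *)

Definition pi2 (P : nat -> Prop) : Prop :=
  exists2 K, semidecidable K & forall n, P n <-> forall u, K (npair n u).

Lemma pi2_ext P Q : (forall n, P n <-> Q n) -> pi2 P -> pi2 Q.
Proof. by move=> PQ [K HK HP]; exists K => // n; rewrite -PQ. Qed.

Lemma pi2_comp2 (R : nat -> nat -> Prop) f g :
    pi2 (fun z => R (nleft z) (nright z)) ->
    recursive_fun f -> recursive_fun g ->
  pi2 (fun z => R (f z) (g z)).
Proof.
move=> [K HK HR] Hf Hg.
exists (fun z => K (npair (npair (f (nleft z)) (g (nleft z))) (nright z))).
  apply: (semidecidable_comp HK); apply: recursive_pair; last by recursive.
  exact: (recursive_comp (recursive_pair Hf Hg) (recursive_left recursive_id)).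
have HR' n m : R n m <-> forall u, K (npair (npair n m) u).
  by rewrite -HR nleft_pair nright_pair.
by move=> n; rewrite HR'; split=> H u; have := H u; rewrite nleft_pair nright_pair.
Qed.

Lemma pi2_semidecidable P : semidecidable P -> pi2 P.
Proof.
move=> HP; exists (fun z => P (nleft z)).
  exact: (semidecidable_comp HP (recursive_left recursive_id)).
move=> n; split=> [Pn u|/(_ 0)]; by rewrite nleft_pair.
Qed.

Lemma pi2_all (P : nat -> nat -> Prop) :
  pi2 (fun z => P (nleft z) (nright z)) -> pi2 (fun n => forall m, P n m).
Proof.
move=> [K HK HP].
exists (fun z => K (npair (npair (nleft z) (nleft (nright z))) (nright (nright z)))).
  by apply: (semidecidable_comp HK); recursive.
have HP' n m : P n m <-> forall u, K (npair (npair n m) u).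
  by rewrite -HP nleft_pair nright_pair.
move=> n; split=> [Pn v|H m].
  by move/HP': (Pn (nleft v)); rewrite nleft_pair nright_pair.
by apply/HP' => u; have := H (npair m u); rewrite !(nleft_pair, nright_pair).
Qed.

Lemma pi2_and P Q : pi2 P -> pi2 Q -> pi2 (fun n => P n /\ Q n).
Proof.
move=> [K HK HP] [L HL HQ]; exists (fun z => K z /\ L z).
  exact: semidecidable_and.
move=> n; rewrite HP HQ; split=> [[Kn Ln] u|H]; first by split.
by split=> u; case: (H u).
Qed.

(** The two universal quantifiers are pulled out independently; classically, counterexamples to both
    disjuncts pair up to one against the joint matrix. *)
Lemma pi2_or P Q : pi2 P -> pi2 Q -> pi2 (fun n => P n \/ Q n).
Proof.
move=> [K HK HP] [L HL HQ].
exists (fun z => K (npair (nleft z) (nleft (nright z))) \/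
                 L (npair (nleft z) (nright (nright z)))).
  by apply: semidecidable_or; [apply: (semidecidable_comp HK) |
    apply: (semidecidable_comp HL)]; recursive.
move=> n; rewrite HP HQ; split=> [[Kn|Ln] u|H].
- by rewrite !nleft_pair; left.
- by rewrite !nleft_pair; right.
apply: NNPP => /not_or_and[/not_all_ex_not[u Ku] /not_all_ex_not[v Lv]].
by case: (H (npair u v)); rewrite !(nleft_pair, nright_pair).
Qed.

(** A Sigma_1 premise turns into a universal quantifier over its witnesses, guarded by the negation
    of a recursive test. *)
Lemma pi2_imply P Q : semidecidable P -> pi2 Q -> pi2 (fun n => P n -> Q n).
Proof.
move=> [b Hb HP] [K HK HQ].
exists (fun z => ~~ b (npair (nleft z) (nleft (nright z))) \/
                 K (npair (nleft z) (nright (nright z)))).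
  apply: semidecidable_or; last by apply: (semidecidable_comp HK); recursive.
  apply: semidecidable_test; apply: recursive_neg; apply: (recursive_comp Hb).
  by recursive.
move=> n; split=> [PQ u|H /HP[v bv]].
  rewrite !(nleft_pair, nright_pair); case: (boolP (b _)) => [Hu|_]; last by left.
  have /PQ/HQ Kn : P n by apply/HP; exists (nleft u).
  by right.
apply/HQ => u; case: (H (npair v u)); rewrite !(nleft_pair, nright_pair) // bv.
by [].
Qed.

Lemma choice_list (R : nat -> nat -> Prop) b :
    (forall m, m <= b -> exists u, R m u) ->
  exists us, forall m, m <= b -> R m (nhead (iter m ntail us)).
Proof.
elim: b R => [|b IHb] R HR; have [u Hu] := HR 0 (leq0n _).
  by exists (npush u 0) => -[|//] _; rewrite /= nhead_push.
have [|us Hus] := IHb (fun m => R m.+1); first by move=> m le_mb; exact: HR.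
exists (npush u us) => -[|m] le_mb; first by rewrite /= nhead_push.
by rewrite iterSr ntail_push; exact: Hus.
Qed.

(* If every [m <= b] had a counterexample, then listing one for each [m] would
   refute the matrix on the right-hand side: bounded quantification commutes
   with the universal quantifier up to a choice list. *)
Lemma pi2_bounded_ex (P : nat -> nat -> Prop) f :
    recursive_fun f -> pi2 (fun z => P (nleft z) (nright z)) ->
  pi2 (fun n => exists m, m <= f n /\ P n m).
Proof.
move=> Hf [K HK HP].
have HP' n m : P n m <-> forall u, K (npair (npair n m) u).
  by rewrite -HP nleft_pair nright_pair.
exists (fun z => exists m, m <= f (nleft z) /\
    K (npair (npair (nleft z) m) (nhead (iter m ntail (nright z))))).
  apply: semidecidable_ex; apply: semidecidable_and.
    apply: semidecidable_test; apply: recursive_leq; first by recursive.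
    by apply: (recursive_comp Hf); recursive.
  by apply: (semidecidable_comp HK); recursive.
move=> n; split=> [[m [le_mf /HP' Km]] us|H].
  by exists m; rewrite nleft_pair.
apply: NNPP => Hno; have [|us Hus] := @choice_list
    (fun m u => ~ K (npair (npair n m) u)) (f n).
  move=> m le_mf; apply: not_all_ex_not => Km; apply: Hno; exists m; split=> //.
  exact/HP'.
have [m] := H us; rewrite nleft_pair nright_pair => -[le_mf]; exact: Hus.
Qed.

(* The diagonal set [{e | exists u, ~ halts e (npair e u)}] is recursively
   enumerable in the halting problem, and differs at [e] from the Pi_2 set
   [{n | forall u, halts e (npair n u)}]. *)
Lemma pi2_not_Sigma2_hard Q : pi2 Q -> ~ Sigma_hard 2 Q.
Proof.
move=> [K HK HQ] Hhard.
pose D e := exists u, ~ halts e (npair e u).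
have HD : Sigma 2 D.
  apply: Sigma_succ (Sigma_one (semidecidable_re semidecidable_halts)) _.
  set O := fun z : nat => _.
  (* On [npair e u] the oracle is asked whether [halts e (npair e u)]; [Mu] stops at the first [u]
     with answer 0. *)
  exists (Mu (Comp Oracle (Pair Left identity_prog))) => e.
  have HO z v : computes O (Comp Oracle (Pair Left identity_prog)) (npair e z) v <->
      (halts e (npair e z) /\ v = 1) \/ (~ halts e (npair e z) /\ v = 0).
    have OE : O (npair e (npair e z)) <-> halts e (npair e z).
      by rewrite /O nleft_pair nright_pair.
    split=> [[y [a [x [-> [x1 [x2 [-> -> ->]]] ->]]]]|].
      by rewrite /= nleft_pair nright_pair OE.
    move=> H; exists (npair e (npair e z)); last by rewrite /= OE.
    exists e, (npair e z); split=> //=; first by rewrite nleft_pair.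
    by exists e, z; rewrite nleft_pair nright_pair.
  split=> [exu|[m [/HO[[_ //]|[Hm _]] _]]]; last by exists m.
  (* Halting is not a boolean test, so the least witness is obtained classically. *)
  have [m [Hm Hmin]] : exists m, ~ halts e (npair e m) /\
      forall k, k < m -> halts e (npair e k).
    case: exu => u; elim/ltn_ind: u => u IHu Hu.
    case: (classic (forall k, k < u -> halts e (npair e k))); first by exists u.
    move=> /not_all_ex_not[k Hk]; have [lt_ku nHk] := imply_to_and _ _ Hk.
    exact: IHu lt_ku nHk.
  exists m; split=> [|k lt_km]; first by apply/HO; right.
  by exists 0; apply/HO; left; split=> //; exact: Hmin.
have [g Hg HDg] := Hhard D HD.
(* [e] is an index of the matrix of [Q] pulled back along the reduction [g]: then [Q (g e)] says
   that [e] halts on every [npair e u], the negation of [D e]. *)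
have [|e He] := @semidecidable_prog (fun z => K (npair (g (nleft z)) (nright z))).
  apply: (semidecidable_comp HK); apply: recursive_pair; last by recursive.
  exact: (recursive_comp Hg (recursive_left recursive_id)).
have HDe : D e <-> forall u, halts e (npair e u).
  by rewrite HDg HQ; split=> H u; have := H u; rewrite -He nleft_pair nright_pair.
have nD : ~ D e by move=> De; case: (De) => u; apply; exact: (proj1 HDe De).
by apply: (nD); apply/HDe => u; apply: NNPP => Hu; apply: nD; exists u.
Qed.

(** Every set is recursively enumerable in itself, so Sigma_n is contained in the next level. *)
Lemma Sigma_hardS n Q : Sigma_hard n.+1 Q -> Sigma_hard n Q.
Proof.
move=> Hhard P HP; apply: Hhard; apply: Sigma_succ HP _.
(* Exchanges the answers 0 and 1: the search then stops at once on members of [P] and never on other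
   inputs. *)
pose neg := Prec (Comp Succ Zero) Zero.
exists (Mu (Comp neg (Pair Zero (Comp Oracle Left)))) => x.
split=> [Px|[m [[_ [a [b [_ [_ -> Hb] ->]]] Hneg] _]]].
  exists 0; split=> //; exists (npair 0 1).
    exists 0, 1; split=> //; exists x; first by rewrite /= nleft_pair.
    by left.
  by rewrite computes_precE nright_pair; exists 1; first exists 0.
case: Hb Hneg => [[+ _]|[_ ->]]; first by rewrite nleft_pair.
by rewrite -/(computes P neg _ 0) computes_precE nright_pair => -[].
Qed.

(** * Non-recursive trade-offs *)

(** No program computing the alphabet of a descriptor is provided; this relation, semidecidable
    through the enumeration by size, gives access to it. *)
Definition describes_over (S : descriptional_system) (A n : nat) : Prop :=
  desc S (CodeSeq.decode n) /\
  Defs.over (CodeSeq.decode A) (lang S (CodeSeq.decode n)).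

Lemma semidecidable_desc S : semidecidable (word_set (desc S)).
Proof.
have [p Hp] := desc_recursive S.
apply: semidecidable_ext (semidecidable_computes p recursive_id (recursive_const 1)).
move=> n; case: (Hp n) => -[Hn Hpn]; first by split.
by split=> // /computes_functional/(_ Hpn).
Qed.

Lemma semidecidable_describes_over S c :
  complexity_measure S c ->
  semidecidable (fun z => describes_over S (nleft z) (nright z)).
Proof.
move=> Hc; have [p Hp] := measure_enum Hc.
apply: (semidecidable_ext (P := fun z => exists i,
    computes no_oracle p (npair (nleft z) i) (nright z))) => [z|].
  have [H _] := Hp (CodeSeq.decode (nleft z)).
  by rewrite /describes_over H !CodeSeq.decodeK.
by apply: semidecidable_ex; apply: semidecidable_computes; recursive.
Qed.

Lemma semidecidable_acceptance S :
  exists2 acc : nat -> nat -> Prop,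
    semidecidable (fun z => acc (nleft z) (nright z)) &
    forall n w, desc S (CodeSeq.decode n) ->
      {subset CodeSeq.decode w <= alph (lang S (CodeSeq.decode n))} ->
      (acc n w <-> lang S (CodeSeq.decode n) (CodeSeq.decode w)).
Proof.
have [p Hp] := lang_to_semidecider S.
exists (fun n w => exists m, computes no_oracle p n m /\
                             exists t, tm_accept_at m w t).
  apply: semidecidable_ex; apply: semidecidable_and.
    by apply: semidecidable_computes; recursive.
  apply: semidecidable_ex; apply: semidecidable_test.
  by apply: recursive_tm_accept_at; recursive.
move=> n w /Hp[M []]; rewrite CodeSeq.decodeK => HM semiM /semiM <-.
rewrite tm_acceptsP CodeSeq.decodeK; split=> [[m [Hm]]|]; last by exists (tm_code M).
by rewrite (computes_functional Hm HM).
Qed.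

(** The program for the measure is specified on descriptors only, hence a semidecidable graph
    instead of a recursive function. *)
Lemma semidecidable_measure S c :
  complexity_measure S c ->
  exists2 G : nat -> nat -> Prop,
    semidecidable (fun z => G (nleft z) (nright z)) &
    forall n m, desc S (CodeSeq.decode n) -> (G n m <-> m = c (CodeSeq.decode n)).
Proof.
move=> Hc; have [p Hp] := measure_recursive Hc.
exists (fun n m => computes no_oracle p n m).
  by apply: semidecidable_computes; recursive.
move=> n m /Hp; rewrite CodeSeq.decodeK => Hn.
by split=> [/computes_functional/(_ Hn)|->].
Qed.

(* Acceptance is meaningful only for words over the alphabet of the described
   language, hence the first alternative. *)
Definition lang_equiv (R1 R2 acc1 acc2 : nat -> nat -> Prop) (n d : nat) : Prop :=
  [/\ forall A, R1 A n -> R2 A d, forall A, R2 A d -> R1 A n &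
      forall w, (exists A, R1 A n /\ ~~ nsubset w A) \/
                ((acc1 n w -> acc2 d w) /\ (acc2 d w -> acc1 n w))].

Lemma pi2_lang_equiv R1 R2 acc1 acc2 :
    semidecidable (fun z => R1 (nleft z) (nright z)) ->
    semidecidable (fun z => R2 (nleft z) (nright z)) ->
    semidecidable (fun z => acc1 (nleft z) (nright z)) ->
    semidecidable (fun z => acc2 (nleft z) (nright z)) ->
  pi2 (fun z => lang_equiv R1 R2 acc1 acc2 (nleft z) (nright z)).
Proof.
move=> HR1 HR2 Hacc1 Hacc2.
apply: (pi2_ext (P := fun z =>
  (forall A, R1 A (nleft z) -> R2 A (nright z)) /\
  ((forall A, R2 A (nright z) -> R1 A (nleft z)) /\
  (forall w, (exists A, R1 A (nleft z) /\ ~~ nsubset w A) \/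
     ((acc1 (nleft z) w -> acc2 (nright z) w) /\
      (acc2 (nright z) w -> acc1 (nleft z) w)))))) => [z|].
  by split=> [[? []]|[]].
apply: pi2_and; last apply: pi2_and.
- apply: pi2_all; apply: pi2_imply; last apply: pi2_semidecidable.
    semidecidable_atom.
  semidecidable_atom.
- apply: pi2_all; apply: pi2_imply; last apply: pi2_semidecidable.
    semidecidable_atom.
  semidecidable_atom.
apply: pi2_all; apply: pi2_or.
  apply: pi2_semidecidable; apply: semidecidable_ex; apply: semidecidable_and.
    semidecidable_atom.
  apply: semidecidable_test; apply: recursive_neg; apply: recursive_nsubset;
    by recursive.
by apply: pi2_and; apply: pi2_imply; try apply: pi2_semidecidable;
  semidecidable_atom.
Qed.

Lemma lang_equivP S1 S2 (acc1 acc2 : nat -> nat -> Prop) n d :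
    (forall n w, desc S1 (CodeSeq.decode n) ->
       {subset CodeSeq.decode w <= alph (lang S1 (CodeSeq.decode n))} ->
       (acc1 n w <-> lang S1 (CodeSeq.decode n) (CodeSeq.decode w))) ->
    (forall n w, desc S2 (CodeSeq.decode n) ->
       {subset CodeSeq.decode w <= alph (lang S2 (CodeSeq.decode n))} ->
       (acc2 n w <-> lang S2 (CodeSeq.decode n) (CodeSeq.decode w))) ->
    desc S1 (CodeSeq.decode n) -> desc S2 (CodeSeq.decode d) ->
  lang_equiv (describes_over S1) (describes_over S2) acc1 acc2 n d <->
  lang_eq (lang S2 (CodeSeq.decode d)) (lang S1 (CodeSeq.decode n)).
Proof.
set L1 := lang S1 _; set L2 := lang S2 _ => Hacc1 Hacc2 Hn Hd.
split=> [[R12 R21 Hw]|[eq_alph eq_L]]; last first.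
  split=> [A [_ HA]|A [_ HA]|w].
  - by split=> // a; rewrite eq_alph; exact: HA.
  - by split=> // a Ha; apply: HA; rewrite eq_alph.
  case: (classic {subset CodeSeq.decode w <= alph L1}) => Hsub; last first.
    left; exists (CodeSeq.code (alph L1)); rewrite /describes_over CodeSeq.codeK.
    split; first by split=> // a.
    by apply/nsubsetP; rewrite CodeSeq.codeK.
  have Hsub2 : {subset CodeSeq.decode w <= alph L2}.
    by move=> a /Hsub; rewrite eq_alph.
  by right; rewrite (Hacc1 _ _ Hn Hsub) (Hacc2 _ _ Hd Hsub2) eq_L.
(* Containment in the same finite sets forces equal alphabets: each alphabet is itself such a
   set. *)
have sub21 : {subset alph L2 <= alph L1}.
  have [|_] := R12 (CodeSeq.code (alph L1)); last by rewrite CodeSeq.codeK.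
  by split=> //; rewrite CodeSeq.codeK => a.
have sub12 : {subset alph L1 <= alph L2}.
  have [|_] := R21 (CodeSeq.code (alph L2)); last by rewrite CodeSeq.codeK.
  by split=> //; rewrite CodeSeq.codeK => a.
split=> [a|w]; first by apply/idP/idP => [/sub21|/sub12].
rewrite -[w]CodeSeq.codeK.
case: (classic {subset CodeSeq.decode (CodeSeq.code w) <= alph L1}) => Hsub; last first.
  by split=> /lang_alph Hsub'; case: Hsub => // a /Hsub' // /sub21.
have Hsub2 : {subset CodeSeq.decode (CodeSeq.code w) <= alph L2}.
  by move=> a /Hsub/sub12.
rewrite -(Hacc1 _ _ Hn Hsub) -(Hacc2 _ _ Hd Hsub2).
case: (Hw (CodeSeq.code w)) => [[A [[_ HA] /nsubsetP[]]]|[]]; last by split.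
by move=> a /Hsub; exact: HA.
Qed.

(** [measure_finite] treats one size at a time; induction collects the sizes up to [N]. The bound
    merely exists, with no claim that it is computable. *)
Lemma bounded_codes S c A N :
    complexity_measure S c ->
  exists b, forall d, describes_over S A d -> c (CodeSeq.decode d) <= N -> d <= b.
Proof.
move=> Hc; elim: N.+1 {-2}N (ltnSn N) => // k IHk {}N; rewrite ltnS => le_Nk.
have [s Hs] := measure_finite Hc (CodeSeq.decode A) N.
have [b Hb] : exists b, forall d, describes_over S A d ->
    c (CodeSeq.decode d) < N -> d <= b.
  case: N le_Nk {s Hs} => [|N] lt_Nk; first by exists 0.
  by have [b Hb] := IHk N lt_Nk; exists b => d Hd; rewrite ltnS; exact: Hb.
exists (maxn b (\max_(D <- s) CodeSeq.code D)) => d Hd.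
rewrite leq_eqVlt => /predU1P[cN|/(Hb d Hd) le_db]; rewrite leq_max ?le_db //.
have [Hdesc Hover] := Hd; have Hin := Hs _ Hdesc Hover cN.
apply/orP; right; rewrite -{1}[d]CodeSeq.decodeK.
exact: (@leq_bigmax_seq _ s xpredT CodeSeq.code).
Qed.

(* A descriptor is equivalent to none in S2 iff, for some bound [b], neither a
   small enough S2-descriptor beyond [b] (a Sigma_1 event) nor one below [b] is
   equivalent to it: by finiteness of each size, large [b] make the first
   alternative fail. *)
Lemma pi2_ness S1 S2 c1 c2 f :
    complexity_measure S1 c1 -> complexity_measure S2 c2 ->
    recursive_fun f -> upper_bound S1 S2 c1 c2 f ->
  pi2 (ness S2 S1).
Proof.
move=> Hc1 Hc2 Hf [_ Hbound].
have HR1 := semidecidable_describes_over Hc1.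
have HR2 := semidecidable_describes_over Hc2.
have [acc1 Sacc1 Hacc1] := semidecidable_acceptance S1.
have [acc2 Sacc2 Hacc2] := semidecidable_acceptance S2.
have [G1 SG1 HG1] := semidecidable_measure Hc1.
have [G2 SG2 HG2] := semidecidable_measure Hc2.
pose small d k := exists m, m <= f k /\ G2 d m.
pose eqv := lang_equiv (describes_over S1) (describes_over S2) acc1 acc2.
have Heqv n d : desc S1 (CodeSeq.decode n) -> desc S2 (CodeSeq.decode d) ->
    eqv n d <-> lang_eq (lang S2 (CodeSeq.decode d)) (lang S1 (CodeSeq.decode n)).
  exact: lang_equivP.
have Hsmall d k : desc S2 (CodeSeq.decode d) ->
    small d k <-> c2 (CodeSeq.decode d) <= f k.
  move=> Hd; split=> [[m [le_m /(HG2 _ _ Hd) <-]] //|le_c].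
  by exists (c2 (CodeSeq.decode d)); split=> //; apply/HG2.
(* An alphabet [A] and the size [k] are only semidecidably related to [n], so they enter through
   universal quantifiers with Sigma_1 premises. *)
apply: (pi2_ext (P := fun n => word_set (desc S1) n /\
  forall A, describes_over S1 A n -> forall k, G1 n k -> forall b,
    (exists d, b < d /\ (describes_over S2 A d /\ small d k)) \/
    (exists d, d <= b /\ ((describes_over S2 A d /\ small d k) /\ eqv n d)))).
  move=> n; rewrite /ness /word_set; set D1 := CodeSeq.decode n.
  split=> -[HD1 H]; split=> //; last first.
    move=> A [_ HA] k /(HG1 _ _ HD1) -> b.
    have [D2 [HD2 eqD2] le_c] := Hbound D1 HD1 H.
    have HR : describes_over S2 A (CodeSeq.code D2) /\ small (CodeSeq.code D2) (c1 D1).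
      rewrite /describes_over Hsmall CodeSeq.codeK //; split=> //; split=> // a.
      by case: eqD2 => -> _; exact: HA.
    (* Whatever [b] is, the code of the equivalent descriptor [D2] lies beyond it or not, which
       selects the alternative. *)
    case: (leqP (CodeSeq.code D2) b) => [le_b|lt_b]; [right | left].
      exists (CodeSeq.code D2); do 2!split=> //.
      by apply/Heqv; rewrite ?CodeSeq.codeK.
    by exists (CodeSeq.code D2).
  pose A := CodeSeq.code (alph (lang S1 D1)).
  have HA : describes_over S1 A n by split=> //; rewrite CodeSeq.codeK => a.
  (* With this [b] no small descriptor lies beyond, so the second alternative must supply an
     equivalent one. *)
  have [b Hb] := bounded_codes A (f (c1 D1)) Hc2.
  case: (H A HA (c1 D1) _ b) => [|[d [lt_bd [Hd]]]|[d [_ [[[Hd _] _] eq_d]]]].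
  - exact/HG1.
  - by case: (Hd) => Hdesc _ /(Hsmall _ _ Hdesc)/(Hb d Hd); rewrite leqNgt lt_bd.
  by exists (CodeSeq.decode d); split=> //; apply/Heqv.
have Ssmall g h : recursive_fun g -> recursive_fun h ->
    semidecidable (fun z => small (g z) (h z)).
  move=> Hg Hh; apply: semidecidable_comp2 => //.
  apply: semidecidable_ex; apply: semidecidable_and.
    apply: semidecidable_test; apply: recursive_leq; first by recursive.
    by apply: (recursive_comp Hf); recursive.
  semidecidable_atom.
apply: pi2_and; first exact/pi2_semidecidable/semidecidable_desc.
apply: pi2_all; apply: pi2_imply.
  semidecidable_atom.
apply: pi2_all; apply: pi2_imply.
  semidecidable_atom.
apply: pi2_all; apply: pi2_or.
  apply: pi2_semidecidable; apply: semidecidable_ex; apply: semidecidable_and.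
    by apply: semidecidable_test; recursive.
  apply: semidecidable_and; last by apply: Ssmall; recursive.
  semidecidable_atom.
apply: pi2_bounded_ex; first by recursive.
apply: pi2_and.
  apply: pi2_semidecidable; apply: semidecidable_and; last by apply: Ssmall; recursive.
  semidecidable_atom.
by apply: (pi2_comp2 (R := eqv)); [exact: pi2_lang_equiv | recursive | recursive].
Qed.

Theorem theorem4 (S1 S2 : descriptional_system) (c1 c2 : word -> nat)
    (Hc1 : complexity_measure S1 c1) (Hc2 : complexity_measure S2 c2)
    (Hcap : exists L : language, described S1 L /\ described S2 L) :
  (recursive_system S1 /\ recursive_system S2 /\ Sigma_hard 2 (ness S2 S1)) \/
  ((~ recursive_system S1 \/ ~ recursive_system S2) /\
     Sigma_hard 3 (ness S2 S1)) ->
  nonrecursive_tradeoff S1 S2 c1 c2.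
Proof.
move=> Hhard [f Hf Hbound].
apply: (pi2_not_Sigma2_hard (pi2_ness Hc1 Hc2 Hf Hbound)).
by case: Hhard => [[_ [_]]|[_ /Sigma_hardS]].
Qed.
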